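(* Let $\widehat X_m$ be any optimal solution of problem (RC). Assume that $\|\mathcal{P}_{T^\perp}(F(\widetilde X_m)+\gamma_m\widetilde X_m)\|<1$. Then for any given $\kappa>1$, if $$\rho_m\ \ge\ \frac{\kappa\nu}{b_m}\Big\|\frac1m\mathcal{R}_\Omega^*(\xi)\Big\|,$$ the following inequality holds: $$\frac{1}{2m}\big\|\mathcal{R}_\Omega(\widehat X_m-\overline X)\big\|_2^2\ \le\ \sqrt{2r}\Big(a_m+\frac{b_m}{\kappa}\Big)\rho_m\|\widehat X_m-\overline X\|_F+\frac{\rho_m\gamma_m}{2}\big(\|\overline X\|_F^2-\|\widehat X_m\|_F^2\big).$$
   Context: Let $\mathbb{V}^{n_1\times n_2}$ denote one of $\mathbb{R}^{n_1\times n_2}$, $\mathbb{C}^{n_1\times n_2}$, the real symmetric $n\times n$ matrices, or the Hermitian $n\times n$ matrices (in the last two cases $n_1=n_2=n$; in the first two $n=\min(n_1,n_2)$), regarded as a real inner product space with $\langle X,Y\rangle=\mathrm{Re}\,\mathrm{Tr}(X^{\mathbb{T}}Y)$, where $^{\mathbb{T}}$ is transpose (real case) or conjugate transpose (complex case); $\|\cdot\|$, $\|\cdot\|_*$, $\|\cdot\|_F$ denote spectral, nuclear and Frobenius norms. Let $\{\Theta_1,\dots,\Theta_d\}$ be an orthonormal basis of $\mathbb{V}^{n_1\times n_2}$, $\alpha\subseteq\{1,\dots,d\}$, $\beta=\{1,\dots,d\}\setminus\alpha$, $d_1=|\alpha|$, $d_2=|\beta|$. For $\pi\subseteq\{1,\dots,d\}$,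 $\mathcal{R}_\pi(X)=(\langle\Theta_k,X\rangle)_{k\in\pi}$. The unknown matrix $\overline X\in\mathbb{V}^{n_1\times n_2}$ has rank $r\ge1$. Given indices $\omega_1,\dots,\omega_m\in\beta$, noise $\xi=(\xi_1,\dots,\xi_m)\in\mathbb{R}^m$ and $\nu>0$, the observations are $y_i=\langle\Theta_{\omega_i},\overline X\rangle+\nu\xi_i$; $\mathcal{R}_\Omega(X)=(\langle\Theta_{\omega_1},X\rangle,\dots,\langle\Theta_{\omega_m},X\rangle)^{\mathbb{T}}$ and $\mathcal{R}_\Omega^*(z)=\sum_{i=1}^m z_i\Theta_{\omega_i}$. A function $f:\mathbb{R}^n\to\mathbb{R}^n$ is symmetric if $f(x)=Q^{\mathbb{T}}f(Qx)$ for all signed permutation matrices $Q$; its spectral operator is $F(X)=U\mathrm{Diag}(f(\sigma(X)))V^{\mathbb{T}}$, where $\sigma(X)$ is the vector of singular values in nonincreasing order and $X=U\mathrm{Diag}(\sigma(X))V^{\mathbb{T}}$ with $U,V$ orthogonal/unitary. Given an initial estimator $\widetilde X_m$ and parameters $\rho_m>0$, $\gamma_m\ge0$, problem (RC) is $$\min_{X\in\mathbb{V}^{n_1\times n_2}}\ \frac1{2m}\|y-\mathcal{R}_\Omega(X)\|_2^2+\rho_m\Big(\|X\|_*-\langle F(\widetilde X_m),X\rangle+\frac{\gamma_m}{2}\|X-\widetilde X_m\|_F^2\Big)\quad\text{s.t. }\mathcal{R}_\alpha(X)=\mathcal{R}_\alpha(\overline X).$$ Fix $\overline X=\overline U\mathrm{Diag}(\sigma(\overline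 X))\overline V^{\mathbb{T}}$ with $\overline U=[\overline U_1\ \overline U_2]$, $\overline V=[\overline V_1\ \overline V_2]$, $\overline U_1,\overline V_1$ having $r$ columns. Define $\mathcal{P}_T(X)=\overline U_1\overline U_1^{\mathbb{T}}X+X\overline V_1\overline V_1^{\mathbb{T}}-\overline U_1\overline U_1^{\mathbb{T}}X\overline V_1\overline V_1^{\mathbb{T}}$ and $\mathcal{P}_{T^\perp}(X)=\overline U_2\overline U_2^{\mathbb{T}}X\overline V_2\overline V_2^{\mathbb{T}}$, and $$a_m=\|\overline U_1\overline V_1^{\mathbb{T}}-\mathcal{P}_T(F(\widetilde X_m)+\gamma_m\widetilde X_m)\|,\qquad b_m=1-\|\mathcal{P}_{T^\perp}(F(\widetilde X_m)+\gamma_m\widetilde X_m)\|.$$ *)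

(* Defs.v *)
(* Scalars: an arbitrary numClosedFieldType C (e.g. algC, or
   any model of the complex numbers); "real" means  \is Num.real. *)
From HB Require Import structures.
From mathcomp Require Import all_boot all_order all_algebra.
From mathcomp Require Import perm sesquilinear spectral.
From Stdlib Require Import ClassicalEpsilon.
Set Implicit Arguments. Unset Strict Implicit. Unset Printing Implicit Defensive.
Import Order.TTheory GRing.Theory Num.Theory.
Local Open Scope ring_scope.

Section Defs.
Variable C : numClosedFieldType.

Definition ctr m n (A : 'M[C]_(m, n)) : 'M[C]_(n, m) := (map_mx (@Num.conj C) A)^T.

Inductive mat_space := RealMats | ComplexMats | SymMats | HermMats.

Definition in_space (sp : mat_space) n1 n2 (X : 'M[C]_(n1, n2)) : Prop :=
  match sp with
  | RealMats => X \is a realmx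
  | ComplexMats => True
  | SymMats => (n1 = n2) /\ X \is a realmx /\
      forall (i i' : 'I_n1) (j j' : 'I_n2),
        nat_of_ord i = nat_of_ord j' -> nat_of_ord j = nat_of_ord i' -> X i j = X i' j'
  | HermMats => (n1 = n2) /\
      forall (i i' : 'I_n1) (j j' : 'I_n2),
        nat_of_ord i = nat_of_ord j' -> nat_of_ord j = nat_of_ord i' -> X i j = (X i' j')^*
  end.

Definition inner n1 n2 (X Y : 'M[C]_(n1, n2)) : C := 'Re (\tr (ctr X *m Y)).

Definition frob n1 n2 (X : 'M[C]_(n1, n2)) : C := sqrtC (inner X X).

Definition rdiag n1 n2 (s : 'rV[C]_(minn n1 n2)) : 'M[C]_(n1, n2) :=
  \matrix_(i, j) \sum_(k < minn n1 n2)
      (if (nat_of_ord i == k) && (nat_of_ord j == k) then s 0 k else 0).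

Definition svd_spec n1 n2 (X : 'M[C]_(n1, n2)) (U : 'M[C]_n1)
  (s : 'rV[C]_(minn n1 n2)) (V : 'M[C]_n2) : Prop :=
  [/\ U \is unitarymx, V \is unitarymx,
      (forall k, 0 <= s 0 k),
      (forall k l : 'I_(minn n1 n2), (k <= l)%N -> s 0 l <= s 0 k)
    & X = U *m rdiag s *m ctr V].

Definition sigma n1 n2 (X : 'M[C]_(n1, n2)) : 'rV[C]_(minn n1 n2) :=
  epsilon (inhabits 0) (fun s => exists U V, svd_spec X U s V).

Definition svdUV n1 n2 (X : 'M[C]_(n1, n2)) : 'M[C]_n1 * 'M[C]_n2 :=
  epsilon (inhabits (1%:M, 1%:M)) (fun p => svd_spec X p.1 (sigma X) p.2).

Definition specnorm n1 n2 (X : 'M[C]_(n1, n2)) : C :=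
  head 0 [seq sigma X 0 k | k <- enum 'I_(minn n1 n2)].

Definition nucnorm n1 n2 (X : 'M[C]_(n1, n2)) : C := \sum_k sigma X 0 k.

Definition signed_perm n (Q : 'M[C]_n) : Prop :=
  exists (p : 'S_n) (d : 'rV[C]_n),
    (forall k, d 0 k = 1 \/ d 0 k = -1) /\ Q = perm_mx p *m diag_mx d.

Definition symmetric_fun n (f : 'rV[C]_n -> 'rV[C]_n) : Prop :=
  (forall x, x \is a realmx -> f x \is a realmx) /\
  forall (x : 'rV[C]_n) Q, x \is a realmx -> signed_perm Q ->
    f x = f (x *m Q^T) *m Q.

Definition spec_op n1 n2 (f : 'rV[C]_(minn n1 n2) -> 'rV[C]_(minn n1 n2))
  (X : 'M[C]_(n1, n2)) : 'M[C]_(n1, n2) :=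
  (svdUV X).1 *m rdiag (f (sigma X)) *m ctr (svdUV X).2.

End Defs.

(* Main.v *)
(** Comparing the objective at [Xhat] and at [Xbar] bounds the loss by
    [nu * <N, D> - rho * (|Xhat|_* - |Xbar|_* - <G, D>)] plus the proximal term,
    where [D = Xhat - Xbar] and [N] is the averaged noise matrix.  Every pairing with
    [D] splits along T and its complement.  On the complement, nuclear/spectral
    duality produces multiples of [z = |PTp D|_*]; on T, a tangent matrix [PT A] has
    Frobenius norm at most [sqrt (2 r)] times the spectral norm of [A], so the rank
    bound is applied to the dual matrices rather than to [PT D].  The total
    coefficient of [z] is [rho * (b / kappa - b) <= 0], and [z] drops out.

    As [sigma] and [svdUV] are chosen by epsilon, the spectral norm is only used
    through the operator bound [opbound], which needs the existence of singular
    value decompositions but not the uniqueness of singular values. *)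

Require Import Defs.
From HB Require Import structures.
From mathcomp Require Import all_boot all_order all_algebra.
From mathcomp Require Import perm sesquilinear spectral.
From mathcomp Require Import ring.
From Stdlib Require Import ClassicalEpsilon.
Import Order.TTheory GRing.Theory Num.Theory.
Local Open Scope ring_scope.
Set Implicit Arguments. Unset Strict Implicit. Unset Printing Implicit Defensive.

(** * Inner product and operator bounds *)

Section Inner.
Variable C : numClosedFieldType.
Local Open Scope sesquilinear_scope.

Lemma ctrE m n (A : 'M[C]_(m, n)) : ctr A = A^t*.
Proof. by rewrite /ctr map_trmx. Qed.

Lemma ctrK m n (A : 'M[C]_(m, n)) : ctr (ctr A) = A.
Proof. by rewrite !ctrE trmxCK. Qed.

Lemma ctrM m n p (A : 'M[C]_(m, n)) (B : 'M[C]_(n, p)) :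
  ctr (A *m B) = ctr B *m ctr A.
Proof. by rewrite /ctr map_mxM trmx_mul. Qed.

Lemma ctrB m n (A B : 'M[C]_(m, n)) : ctr (A - B) = ctr A - ctr B.
Proof. by rewrite /ctr map_mxB linearB. Qed.

Lemma ctr1 n : ctr (1%:M : 'M[C]_n) = 1%:M.
Proof. by rewrite /ctr map_mx1 trmx1. Qed.

Lemma ctr_pid m n r : ctr (pid_mx r : 'M[C]_(m, n)) = pid_mx r.
Proof. by rewrite /ctr map_pid_mx tr_pid_mx. Qed.

Lemma ctr_diag_real n (s : 'rV[C]_n) :
  (forall k, s 0 k \is Num.real) -> ctr (diag_mx s) = diag_mx s.
Proof.
move=> sR; rewrite /ctr map_diag_mx tr_diag_mx; congr diag_mx.
by apply/rowP=> k; rewrite mxE; exact/CrealP.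
Qed.

Lemma unitary_ctrl n (U : 'M[C]_n) : U \is unitarymx -> ctr U *m U = 1%:M.
Proof. by move=> /unitarymxP UU; rewrite ctrE; exact: mulmx1C. Qed.

Section Shape.
Variables m n : nat.
Implicit Types X Y Z : 'M[C]_(m, n).

Lemma innerC X Y : inner X Y = inner Y X.
Proof.
by rewrite /inner -Re_conj -trace_map_mx -mxtrace_tr -/(ctr _) ctrM ctrK.
Qed.

Lemma innerDr X Y Z : inner X (Y + Z) = inner X Y + inner X Z.
Proof. by rewrite /inner mulmxDr !raddfD. Qed.

Lemma innerNr X Y : inner X (- Y) = - inner X Y.
Proof. by rewrite /inner mulmxN !raddfN. Qed.

Lemma innerBr X Y Z : inner X (Y - Z) = inner X Y - inner X Z.
Proof. by rewrite innerDr innerNr. Qed.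

Lemma innerZr a X Y : a \is Num.real -> inner X (a *: Y) = a * inner X Y.
Proof. by move=> aR; rewrite /inner -scalemxAr mxtraceZ ReMl. Qed.

Lemma inner0r X : inner X 0 = 0.
Proof. by rewrite /inner mulmx0 mxtrace0 raddf0. Qed.

Lemma innerDl X Y Z : inner (Y + Z) X = inner Y X + inner Z X.
Proof. by rewrite !(innerC _ X) innerDr. Qed.

Lemma innerBl X Y Z : inner (Y - Z) X = inner Y X - inner Z X.
Proof. by rewrite !(innerC _ X) innerBr. Qed.

Lemma innerNl X Y : inner (- Y) X = - inner Y X.
Proof. by rewrite !(innerC _ X) innerNr. Qed.

Lemma innerZl a X Y : a \is Num.real -> inner (a *: Y) X = a * inner Y X.
Proof. by move=> aR; rewrite !(innerC _ X) innerZr. Qed.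

Lemma inner_sumr k (Y : 'I_k -> 'M[C]_(m, n)) X :
  inner X (\sum_i Y i) = \sum_i inner X (Y i).
Proof.
apply: (big_morph (fun Z => inner X Z)); [exact: innerDr | exact: inner0r].
Qed.

Lemma inner_normE X : inner X X = \sum_i \sum_j `|X i j| ^+ 2.
Proof.
have -> : inner X X = 'Re (\sum_i \sum_j `|X i j| ^+ 2).
  rewrite /inner /mxtrace exchange_big /=; congr ('Re _).
  apply: eq_bigr => j _; rewrite mxE; apply: eq_bigr => i _.
  by rewrite /ctr !mxE mulrC -normCK.
apply/Creal_ReP/rpred_sum => i _; apply: rpred_sum => j _.
exact/rpredX/normr_real.
Qed.

Lemma inner_ge0 X : 0 <= inner X X.
Proof.
rewrite inner_normE; apply: sumr_ge0 => i _; apply: sumr_ge0 => j _.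
exact/exprn_ge0/normr_ge0.
Qed.

Lemma inner_eq0 X : inner X X = 0 -> X = 0.
Proof.
rewrite inner_normE => /eqP; rewrite psumr_eq0; last first.
  by move=> i _; apply: sumr_ge0 => j _; exact/exprn_ge0/normr_ge0.
move=> /allP X0; apply/matrixP => i j; rewrite mxE.
have := X0 i; rewrite mem_index_enum => /(_ isT) /=.
rewrite psumr_eq0; last by move=> k _; exact/exprn_ge0/normr_ge0.
move=> /allP /(_ j); rewrite mem_index_enum => /(_ isT) /=.
by rewrite sqrf_eq0 normr_eq0 => /eqP.
Qed.

Lemma frob_ge0 X : 0 <= frob X.
Proof. by rewrite sqrtC_ge0 inner_ge0. Qed.

Lemma frob_sqr X : frob X ^+ 2 = inner X X.
Proof. exact: sqrtCK. Qed.

Lemma frob_real X : frob X \is Num.real.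
Proof. exact/ger0_real/frob_ge0. Qed.

Lemma frob_eq0 X : frob X = 0 -> X = 0.
Proof. by move=> X0; apply: inner_eq0; rewrite -frob_sqr X0 expr0n. Qed.

Lemma frob_le X t : 0 <= t -> inner X X <= t ^+ 2 -> frob X <= t.
Proof.
move=> t0 Xt; rewrite -(@ler_pXn2r _ 2) ?nnegrE ?frob_ge0 //.
by rewrite frob_sqr.
Qed.

(** With [a] and [b] the two norms, expand the nonnegative square of [b *: X - a *: Y] and divide by
    [2 * (a * b)]; a zero norm is treated apart. *)
Lemma inner_CauchySchwarz X Y : inner X Y <= frob X * frob Y.
Proof.
set a := frob X; set b := frob Y.
have [a0|an0] := eqVneq a 0.
  by rewrite a0 (frob_eq0 a0) innerC inner0r mul0r.
have [b0|bn0] := eqVneq b 0.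
  by rewrite b0 (frob_eq0 b0) inner0r mulr0.
have ab_gt0 : 0 < 2 * (a * b) by rewrite !mulr_gt0 ?ltr0n // lt_def ?an0 ?bn0 frob_ge0.
rewrite -subr_ge0 -(pmulr_rge0 _ ab_gt0).
have := inner_ge0 (b *: X - a *: Y).
rewrite innerBr !innerBl !innerZr ?frob_real // !innerZl ?frob_real //.
rewrite -!frob_sqr -/a -/b (innerC Y X).
set i := inner X Y; suff -> : 2 * (a * b) * (a * b - i) =
  b * (b * a ^+ 2) - b * (a * i) - (a * (b * i) - a * (a * b ^+ 2)) by [].
ring.
Qed.

End Shape.

Lemma inner_mull m n p (A : 'M[C]_(m, n)) (X : 'M[C]_(n, p)) Y :
  inner (A *m X) Y = inner X (ctr A *m Y).
Proof. by rewrite /inner ctrM mulmxA. Qed.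

Lemma inner_mulr m n p (B : 'M[C]_(n, p)) (X : 'M[C]_(m, n)) Y :
  inner (X *m B) Y = inner X (Y *m ctr B).
Proof. by rewrite /inner ctrM -mulmxA mxtrace_mulC mulmxA. Qed.

Lemma inner_ctr m n (X Y : 'M[C]_(m, n)) : inner (ctr X) (ctr Y) = inner X Y.
Proof. by rewrite innerC /inner ctrK mxtrace_mulC. Qed.

Lemma frob_ctr m n (X : 'M[C]_(m, n)) : frob (ctr X) = frob X.
Proof. by rewrite /frob inner_ctr. Qed.

Lemma frob_isom m n p (P : 'M[C]_(m, n)) (X : 'M[C]_(n, p)) :
  ctr P *m P = 1%:M -> frob (P *m X) = frob X.
Proof. by move=> PP; rewrite /frob inner_mull mulmxA PP mul1mx. Qed.

(** Spectral norm at most [t], tested on blocks [V] of any width. Products and adjoints can then be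
    bounded without singular values. *)
Definition opbound m n (t : C) (A : 'M[C]_(m, n)) :=
  forall p (V : 'M[C]_(n, p)), frob (A *m V) <= t * frob V.

Lemma opbound_mul m n p s t (A : 'M[C]_(m, n)) (B : 'M[C]_(n, p)) :
  0 <= s -> opbound s A -> opbound t B -> opbound (s * t) (A *m B).
Proof.
move=> s0 hA hB q V; rewrite -mulmxA -mulrA.
by apply: le_trans (hA _ _) _; rewrite ler_wpM2l.
Qed.

Lemma opbound_mul1 m n p (A : 'M[C]_(m, n)) (B : 'M[C]_(n, p)) :
  opbound 1 A -> opbound 1 B -> opbound 1 (A *m B).
Proof. by move=> hA hB; rewrite -(mulr1 1); apply: opbound_mul. Qed.

Lemma opbound_isom m n (P : 'M[C]_(m, n)) : ctr P *m P = 1%:M -> opbound 1 P.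
Proof. by move=> PP p V; rewrite frob_isom // mul1r. Qed.

(** The square of [a] is the pairing of [V] with [A *m (ctr A *m V)], hence at most
    [frob V * (t * a)]; cancel [a]. *)
Lemma opbound_ctr m n t (A : 'M[C]_(m, n)) :
  0 <= t -> opbound t A -> opbound t (ctr A).
Proof.
move=> t0 hA p V; set a := frob _.
have [->|an0] := eqVneq a 0; first by rewrite mulr_ge0 ?frob_ge0.
have a_gt0 : 0 < a by rewrite lt_def an0 frob_ge0.
rewrite -(ler_pM2l a_gt0) -expr2 /a frob_sqr inner_mull ctrK -/a.
apply: le_trans (inner_CauchySchwarz _ _) _.
rewrite [a * _]mulrC [t * _]mulrC -mulrA ler_wpM2l ?frob_ge0 //; exact: hA.
Qed.

Lemma opbound_diag n t (s : 'rV[C]_n) :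
  0 <= t -> (forall k, 0 <= s 0 k <= t) -> opbound t (diag_mx s).
Proof.
move=> t0 hs p V; apply: frob_le; first by rewrite mulr_ge0 ?frob_ge0.
rewrite exprMn frob_sqr !inner_normE mulr_sumr; apply: ler_sum => i _.
rewrite mulr_sumr; apply: ler_sum => j _.
rewrite mul_diag_mx mxE normrM exprMn ler_wpM2r ?exprn_ge0 //.
have /andP[s0 st] := hs i.
by rewrite ger0_norm // ler_pXn2r ?nnegrE.
Qed.

(** Write [diag_mx s] as [E *m E] with [E] its square root, move one factor onto [M] and apply
    Cauchy-Schwarz; the squared norm of [E] is the sum of [s]. *)
Lemma inner_diag_le n t (M : 'M[C]_n) (s : 'rV[C]_n) :
  0 <= t -> (forall k, 0 <= s 0 k) -> opbound t M ->
  inner M (diag_mx s) <= t * \sum_k s 0 k.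
Proof.
move=> t0 s0 hM.
pose E : 'M[C]_n := diag_mx (\row_k sqrtC (s 0 k)).
have EE : E *m E = diag_mx s.
  rewrite /E mulmx_diag; congr diag_mx; apply/rowP=> k.
  by rewrite !mxE -expr2 sqrtCK.
have Ectr : ctr E = E.
  by apply: ctr_diag_real => k; rewrite mxE ger0_real // sqrtC_ge0.
have -> : \sum_k s 0 k = frob E ^+ 2.
  rewrite frob_sqr /inner Ectr EE mxtrace_diag; apply/esym/Creal_ReP.
  by apply: rpred_sum => k _; exact: ger0_real.
rewrite -EE -[X in inner _ (_ *m X)]Ectr -inner_mulr.
apply: le_trans (inner_CauchySchwarz _ _) _.
by rewrite expr2 mulrA ler_wpM2r ?frob_ge0 //; exact: hM.
Qed.

(** Moving the isometries onto [W] compresses it to [ctr P *m W *m Q], which keeps the bound [t].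
    This is the upper half of nuclear/spectral duality. *)
Lemma inner_svd_le m n p t (W : 'M[C]_(m, n)) (P : 'M[C]_(m, p))
    (Q : 'M[C]_(n, p)) (s : 'rV[C]_p) :
  ctr P *m P = 1%:M -> ctr Q *m Q = 1%:M -> (forall k, 0 <= s 0 k) ->
  0 <= t -> opbound t W ->
  inner W (P *m diag_mx s *m ctr Q) <= t * \sum_k s 0 k.
Proof.
move=> PP QQ s0 t0 hW.
rewrite innerC inner_mulr ctrK inner_mull innerC; apply: inner_diag_le => //.
rewrite -[t]mul1r; apply: opbound_mul => //.
  exact/opbound_ctr/opbound_isom.
by rewrite -[t]mulr1; apply: opbound_mul => //; exact: opbound_isom.
Qed.

Lemma inner_svd_eq m n p (P : 'M[C]_(m, p))
    (Q : 'M[C]_(n, p)) (s : 'rV[C]_p) :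
  ctr P *m P = 1%:M -> ctr Q *m Q = 1%:M -> (forall k, 0 <= s 0 k) ->
  inner (P *m ctr Q) (P *m diag_mx s *m ctr Q) = \sum_k s 0 k.
Proof.
move=> PP QQ s0.
rewrite inner_mulr ctrK -mulmxA QQ mulmx1 -[X in inner X _]mulmx1 inner_mull.
rewrite mulmxA PP mul1mx /inner ctr1 mul1mx mxtrace_diag; apply/Creal_ReP.
by apply: rpred_sum => k _; exact: ger0_real.
Qed.

End Inner.

(** * Singular value decomposition *)

Section SVD.
Variable C : numClosedFieldType.
Local Open Scope sesquilinear_scope.

Lemma gram_diag_ge0 m n (B : 'M[C]_(m, n)) d :
  B *m ctr B = diag_mx d -> forall k, 0 <= d 0 k.
Proof.
move=> BB k; have /matrixP /(_ k k) := BB; rewrite !mxE eqxx mulr1n => <-.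
by apply: sumr_ge0 => j _; rewrite !mxE mul_conjC_ge0.
Qed.

Lemma exists_sorting_perm n (d : 'I_n -> C) : (forall k, d k \is Num.real) ->
  exists p : 'S_n, forall k l : 'I_n, (k <= l)%N -> d (p l) <= d (p k).
Proof.
move=> dR; pose leT := [rel i j : 'I_n | d j <= d i].
have leT_total : total leT by move=> i j; rewrite /= orbC real_leVge.
have leT_tr : transitive leT by move=> j i k /= ij jk; exact: le_trans ij.
have leT_refl : reflexive leT by move=> i /=.
pose e := sort leT (enum 'I_n).
have se : size e == n by rewrite size_sort size_enum_ord.
have ue : uniq e by rewrite sort_uniq enum_uniq.
(* The sorted enumeration has length [n] and no repetition, so reading it by position is a
   permutation. *)
pose te := Tuple se.
have inj_te : injective (tnth te) by exact/tuple_uniqP.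
exists (perm inj_te) => k l kl; rewrite !permE !(tnth_nth k) /=.
have := @sorted_leq_nth _ leT leT_tr leT_refl k e (sort_sorted leT_total _).
move=> /(_ k l); apply=> //; by rewrite inE (eqP se).
Qed.

(** Diagonalise [X *m ctr X] by the spectral theorem, then permute the eigenvalues into
    nonincreasing order. *)
Lemma exists_gram_diag m n (X : 'M[C]_(m, n)) :
  exists (P : 'M[C]_m) (d : 'rV[C]_m), [/\ P \is unitarymx,
    (P *m X) *m ctr (P *m X) = diag_mx d
    & forall k l : 'I_m, (k <= l)%N -> d 0 l <= d 0 k].
Proof.
have H_normal : X *m ctr X \is normalmx.
  by apply/normalmxP; rewrite -!ctrE ctrM ctrK.
have /orthomx_spectralP := H_normal.
set P := spectralmx _; set d := spectral_diag _ => HE.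
have PU : P \is unitarymx by exact: spectral_unitarymx.
have PX : (P *m X) *m ctr (P *m X) = diag_mx d.
  rewrite ctrM !mulmxA -(mulmxA P) HE invmx_unitary // -!ctrE !mulmxA.
  have PP : P *m ctr P = 1%:M by rewrite ctrE; exact/unitarymxP.
  by rewrite PP mul1mx -mulmxA PP mulmx1.
have d_real k : d 0 k \is Num.real by rewrite ger0_real // (gram_diag_ge0 PX).
have [p pP] := exists_sorting_perm d_real.
have permU : (perm_mx p : 'M[C]_m) \is unitarymx.
  by apply/unitarymxP; rewrite tr_perm_mx map_perm_mx -perm_mxM mulgV perm_mx1.
exists (perm_mx p *m P), (\row_k d 0 (p k)); split.
- exact: mul_unitarymx.
- rewrite -(mulmxA _ P); move: (P *m X) PX => B PX.
  rewrite ctrM mulmxA -(mulmxA _ B) PX /ctr map_perm_mx tr_perm_mx.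
  rewrite -row_permE -col_permE.
  by apply/matrixP=> i j; rewrite !mxE (inj_eq perm_inj).
- by move=> k l kl; rewrite !mxE; exact: pP.
Qed.

(* The rows of A are orthogonal with the null ones last, so Gram-Schmidt only rescales them. *)
Lemma schmidt_gram_diag n (A : 'M[C]_n) (d : 'rV[C]_n) :
  A *m ctr A = diag_mx d ->
  (forall k l : 'I_n, (k <= l)%N -> d 0 l <= d 0 k) ->
  A = diag_mx (\row_k sqrtC (d 0 k)) *m schmidt A.
Proof.
move=> AA d_sorted; have d_ge0 := gram_diag_ge0 AA.
set S := schmidt A; have SU : S \is unitarymx by exact: schmidt_unitarymx.
have SS : ctr S *m S = 1%:M by exact: unitary_ctrl.
(* [M] holds the coordinates of the rows of [A] in the Gram-Schmidt basis; it has to be shown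
   diagonal. *)
pose M := A *m ctr S.
have AE : A = M *m S by rewrite -mulmxA SS mulmx1.
have MM : M *m ctr M = diag_mx d by rewrite ctrM mulmxA -(mulmxA A) ctrK SS mulmx1.
have MME i j : \sum_k M i k * (M j k)^* = d 0 i *+ (i == j).
  have /matrixP /(_ i j) := MM; rewrite !mxE => <-.
  by apply: eq_bigr => k _; rewrite !mxE.
have Mdiag_ge0 i : 0 <= M i i.
  have := form1_row_schmidt A i; rewrite dotmxE -/S; congr (0 <= _).
  by rewrite !mxE; apply: eq_bigr => k _; rewrite !mxE.
(* Row [i] of [A] lies in the span of the rows of [S] up to [i], all orthogonal to row [j]. *)
have Mlow (i j : 'I_n) : (i < j)%N -> M i j = 0.
  move=> ij; have sub_ker : (row i A <= kermx (ctr (row j S)))%MS.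
    apply: submx_trans (row_schmidt_sub _ _) _; apply/sumsmx_subP => k ki.
    rewrite genmxE; apply/sub_kermxP/matrixP => a b; rewrite !ord1 ctrE -dotmxE.
    rewrite (row_unitarymxP SU) mxE.
    by case: eqP => // kj; move: (leq_ltn_trans ki ij); rewrite kj ltnn.
  have /sub_kermxP /matrixP /(_ 0 0) := sub_ker; rewrite !mxE => Mij; rewrite -[RHS]Mij.
  by apply: eq_bigr => k _; rewrite !mxE.
clearbody M.
(* Strong induction on the column: once row [j] is reduced to its diagonal entry, its orthogonality
   to row [i] reads [M i j * (M j j)^* = 0]. *)
have Mlt (k : nat) : forall j i : 'I_n, (j < k)%N -> i != j -> M i j = 0.
  elim: k => // k IHk j i; rewrite ltnS => jk ij.
  have [ltij|] := ltnP i j; first exact: Mlow.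
  rewrite leq_eqVlt => /predU1P[/val_inj ji|ltji].
    by rewrite ji eqxx in ij.
  have Mj l : l != j -> M j l = 0.
    move=> lj; have [|] := ltnP j l; first exact: Mlow.
    rewrite leq_eqVlt => /predU1P[/val_inj ll|ltlj].
      by rewrite ll eqxx in lj.
    by apply: IHk; [exact: leq_trans jk | rewrite eq_sym].
  have := MME i j; rewrite (bigD1 j) //= big1 ?addr0; last first.
    by move=> l lj; rewrite Mj // conjC0 mulr0.
  rewrite (negPf ij) mulr0n => /eqP; rewrite mulf_eq0 conjC_eq0.
  case/orP=> [/eqP //|/eqP Mjj0].
  (* A zero pivot forces [d 0 j = 0], hence [d 0 i = 0] by the ordering, and then the whole row [i]
     of [M] vanishes. *)
  have dj0 : d 0 j = 0.
    have := MME j j; rewrite eqxx mulr1n => <-; apply: big1 => l _.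
    by have [->|/Mj ->] := eqVneq l j; rewrite ?Mjj0 mul0r.
  have di0 : d 0 i = 0.
    by apply/eqP; rewrite eq_le d_ge0 -dj0 d_sorted // ltnW.
  have := MME i i; rewrite eqxx mulr1n di0 => /eqP.
  rewrite psumr_eq0; last by move=> l _; exact: mul_conjC_ge0.
  move=> /allP /(_ j); rewrite mem_index_enum => /(_ isT) /=.
  by rewrite mul_conjC_eq0 => /eqP.
have M_offdiag i j : i != j -> M i j = 0 by exact: (Mlt n).
rewrite [LHS]AE; congr (_ *m _); apply/matrixP=> i j; rewrite !mxE.
have [<-|/M_offdiag ->] := eqVneq i j; last by rewrite mulr0n.
rewrite mulr1n; have := MME i i; rewrite (bigD1 i) //= big1 ?addr0; last first.
  by move=> l li; rewrite M_offdiag ?mul0r // eq_sym.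
rewrite eqxx mulr1n => <-.
by rewrite -normCK sqrCK ?normr_ge0 // ger0_norm.
Qed.

(** Indexing by [nat] avoids a cast between [minn m n] and [minn n m] under transposition. *)
Definition natdiag m n (s : nat -> C) : 'M[C]_(m, n) :=
  \matrix_(i, j) (s i *+ (nat_of_ord i == nat_of_ord j)).

Lemma exists_svd_wide m n (X : 'M[C]_(m, n)) : (m <= n)%N ->
  exists (U : 'M[C]_m) (s : nat -> C) (V : 'M[C]_n),
  [/\ U \is unitarymx, V \is unitarymx, (forall k, 0 <= s k),
      (forall k l, (k <= l)%N -> s l <= s k) & X = U *m natdiag m n s *m ctr V].
Proof.
move=> mn; have [P [d [PU BB d_sorted]]] := exists_gram_diag X.
have d_ge0 := gram_diag_ge0 BB.
set B := P *m X in BB.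
(* Extension by 0 past [m]; it stays nonincreasing because [d] is nonnegative. *)
pose dn k := if insub k is Some i then d 0 i else 0.
have dn_ge0 k : 0 <= dn k by rewrite /dn; case: insub.
have dnS k l : (k <= l)%N -> dn l <= dn k.
  move=> kl; rewrite /dn; case: (insubP 'I_m l) => [i lm il|_]; last exact: dn_ge0.
  rewrite (insubT (fun x => x < m)%N (leq_ltn_trans kl lm)) d_sorted //=.
  by rewrite il.
(* Null rows are appended to [B] to make it square; they come last, as the Gram-Schmidt lemma
   requires. *)
pose A : 'M[C]_n := pid_mx m *m B.
pose d' : 'rV[C]_n := \row_k dn k.
have AA : A *m ctr A = diag_mx d'.
  rewrite ctrM ctr_pid mulmxA -(mulmxA _ B) BB mul_mx_diag.
  apply/matrixP => i j; rewrite !mxE.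
  have [im|im] := ltnP i m; last first.
    rewrite /dn insubF; last by rewrite ltnNge im.
    rewrite mul0rn big1 // => k _; rewrite !mxE.
    by rewrite ltnNge im /= andbF mul0r mul0r.
  rewrite /dn (insubT (fun x => x < m)%N im) (bigD1 (Ordinal im)) //=.
  rewrite big1 ?addr0; last first.
    move=> k ki; rewrite !mxE; case: eqP => [ik|]; last by rewrite !mul0r.
    by case/eqP: ki; apply/val_inj; rewrite /= ik.
  by rewrite !mxE eqxx im /= andbT mul1r mulr_natr.
have d'S : forall k l : 'I_n, (k <= l)%N -> d' 0 l <= d' 0 k.
  by move=> k l kl; rewrite !mxE dnS.
have AE := schmidt_gram_diag AA d'S.
set S := schmidt A in AE.
have SU : S \is unitarymx by exact: schmidt_unitarymx.
exists (ctr P), (sqrtC \o dn), (ctr S); split.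
- by rewrite ctrE trmxC_unitary.
- by rewrite ctrE trmxC_unitary.
- by move=> k; rewrite /= sqrtC_ge0.
- by move=> k l kl; rewrite /= ler_sqrtC ?nnegrE ?dn_ge0 // dnS.
have -> : X = ctr P *m B by rewrite mulmxA unitary_ctrl // mul1mx.
rewrite ctrK -mulmxA; congr (_ *m _).
have -> : B = pid_mx m *m A.
  by rewrite mulmxA mul_pid_mx minnn (minn_idPr mn) pid_mx_1 mul1mx.
rewrite [in LHS]AE mulmxA; congr (_ *m _); rewrite mul_mx_diag.
by apply/matrixP=> i j; rewrite !mxE ltn_ord andbT; case: eqP => [->|]; rewrite ?mul1r ?mul0r.
Qed.

Lemma exists_svd m n (X : 'M[C]_(m, n)) : exists U s V, svd_spec X U s V.
Proof.
suff [U [s [V [UU VU s0 sS XE]]]] : exists (U : 'M[C]_m) (s : nat -> C) (V : 'M[C]_n),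
  [/\ U \is unitarymx, V \is unitarymx, (forall k, 0 <= s k),
      (forall k l, (k <= l)%N -> s l <= s k) & X = U *m natdiag m n s *m ctr V].
  exists U, (\row_k s k), V; split=> //.
  - by move=> k; rewrite mxE.
  - by move=> k l kl; rewrite !mxE sS.
  rewrite {1}XE; congr (_ *m _ *m _); apply/matrixP=> i j; rewrite !mxE.
  have [ij|ij] := eqVneq (i : nat) j; last first.
    rewrite big1 // => k _; case: andP => // -[/eqP ik /eqP jk].
    by case/eqP: ij; rewrite ik jk.
  have im : (i < minn m n)%N by rewrite leq_min ltn_ord ij ltn_ord.
  rewrite (bigD1 (Ordinal im)) //= mxE -ij !eqxx big1 ?addr0 // => k ki.
  by case: eqP => // ik; case/eqP: ki; apply/val_inj.
have [mn|/ltnW nm] := leqP m n; first exact: exists_svd_wide.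
(* A tall matrix is handled through its adjoint, which exchanges the two unitary factors. *)
have [U [s [V [UU VU s0 sS XE]]]] := exists_svd_wide (ctr X) nm.
exists V, s, U; split=> //.
rewrite -[LHS]ctrK XE !ctrM ctrK mulmxA; congr (_ *m _ *m _).
apply/matrixP=> i j; rewrite !mxE eq_sym rmorphMn /=.
by case: eqP => // ->; rewrite ?mulr1n geC0_conj.
Qed.

Lemma sigmaP m n (X : 'M[C]_(m, n)) : exists U V, svd_spec X U (sigma X) V.
Proof.
have [U [s [V XE]]] := exists_svd X.
by apply: (epsilon_spec _ (fun s => exists U V, svd_spec X U s V)); exists s, U, V.
Qed.

Lemma rdiagE m n (s : 'rV[C]_(minn m n)) :
  rdiag s = pid_mx (minn m n) *m diag_mx s *m pid_mx (minn m n) :> 'M[C]_(m, n).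
Proof.
rewrite mul_mx_diag; apply/matrixP=> i j; rewrite !mxE; apply: eq_bigr => k _.
rewrite !mxE [(k : nat) == j]eq_sym ltn_ord !andbT.
case: eqP => [->|]; rewrite ?ltn_ord /= ?mul1r ?mul0r //.
by case: eqP; rewrite ?mulr1 ?mulr0.
Qed.

Lemma isom_mul_pid m r (U : 'M[C]_m) : (r <= m)%N -> U \is unitarymx ->
  ctr (U *m (pid_mx r : 'M[C]_(m, r))) *m (U *m pid_mx r) = 1%:M.
Proof.
move=> rm UU; rewrite ctrM ctr_pid mulmxA -(mulmxA _ (ctr U)) unitary_ctrl //.
by rewrite mulmx1 mul_pid_mx minnn (minn_idPr rm) pid_mx_1.
Qed.

(** Only the first [minn m n] columns of the unitary factors are kept; the core becomes square, as
    the duality lemmas need. *)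
Lemma exists_thin_svd m n (X : 'M[C]_(m, n)) :
  exists (P : 'M[C]_(m, minn m n)) (Q : 'M[C]_(n, minn m n)),
  [/\ ctr P *m P = 1%:M, ctr Q *m Q = 1%:M, (forall k, 0 <= sigma X 0 k),
      (forall k l : 'I_(minn m n), (k <= l)%N -> sigma X 0 l <= sigma X 0 k)
    & X = P *m diag_mx (sigma X) *m ctr Q].
Proof.
have [U [V [UU VU s0 sS XE]]] := sigmaP X.
exists (U *m pid_mx (minn m n)), (V *m pid_mx (minn m n)); split=> //.
- by rewrite isom_mul_pid // geq_minl.
- by rewrite isom_mul_pid // geq_minr.
by rewrite {1}XE rdiagE ctrM ctr_pid !mulmxA.
Qed.

(** * Spectral and nuclear norms and their duality *)

Lemma nucnorm_ge0 m n (X : 'M[C]_(m, n)) : 0 <= nucnorm X.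
Proof. by have [P [Q [_ _ s0 _ _]]] := exists_thin_svd X; exact: sumr_ge0. Qed.

Lemma sigma_le_specnorm m n (X : 'M[C]_(m, n)) k : sigma X 0 k <= specnorm X.
Proof.
have [P [Q [_ _ _ sS _]]] := exists_thin_svd X.
rewrite /specnorm; move: (sigma X) k sS; move: (minn m n) => [|q] s k sS.
  by case: k.
by rewrite enum_ordSl /= sS.
Qed.

Lemma specnorm_ge0 m n (X : 'M[C]_(m, n)) : 0 <= specnorm X.
Proof.
have [P [Q [_ _ s0 _ _]]] := exists_thin_svd X.
rewrite /specnorm; move: (sigma X) s0; move: (minn m n) => [|q] s s0.
  (* Without singular values [head] returns its default 0. *)
  by rewrite (size0nil (size_enum_ord 0)).
by rewrite enum_ordSl /=.
Qed.

Lemma opbound_specnorm m n (X : 'M[C]_(m, n)) : opbound (specnorm X) X.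
Proof.
have [P [Q [PP QQ s0 _ XE]]] := exists_thin_svd X.
rewrite {2}XE -[specnorm X]mulr1; apply: opbound_mul (specnorm_ge0 _) _ _.
  rewrite -[specnorm X]mul1r; apply: opbound_mul => //; first exact: opbound_isom.
  by apply: opbound_diag (specnorm_ge0 _) _ => k; rewrite s0 sigma_le_specnorm.
exact/opbound_ctr/opbound_isom.
Qed.

Lemma inner_nucnorm_le m n t (W X : 'M[C]_(m, n)) :
  0 <= t -> opbound t W -> inner W X <= t * nucnorm X.
Proof.
move=> t0 hW; have [P [Q [PP QQ s0 _ XE]]] := exists_thin_svd X.
by rewrite {1}XE; exact: inner_svd_le.
Qed.

(** The maximiser is the sign matrix [P *m ctr Q] of a thin decomposition. *)
Lemma nucnorm_attained m n (X : 'M[C]_(m, n)) :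
  exists2 W, opbound 1 W & inner W X = nucnorm X.
Proof.
have [P [Q [PP QQ s0 _ XE]]] := exists_thin_svd X.
exists (P *m ctr Q); last by rewrite {1}XE inner_svd_eq.
by apply: opbound_mul1; [|apply: opbound_ctr => //]; exact: opbound_isom.
Qed.

(** * Rank and the compact singular value decomposition *)

Lemma svd_spec_rank m n (X : 'M[C]_(m, n)) U s V : svd_spec X U s V ->
  forall k : 'I_(minn m n), (\rank X <= k)%N -> s 0 k = 0.
Proof.
move=> [UU VU s0 sS XE] k rk; apply/eqP/negPn/negP => sk0.
(* If [s 0 k] were nonzero, so would be all earlier entries; inverting them turns [diag_mx s] cut at
   [k.+1] into a matrix of rank [k.+1]. Later entries are masked by [pid_mx]. *)
pose s' : 'rV[C]_(minn m n) := \row_j (s 0 j)^-1.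
have kmin : (k < minn m n)%N by [].
have DE : diag_mx s = pid_mx (minn m n) *m ctr U *m X *m V *m pid_mx (minn m n).
  rewrite XE !mulmxA -(mulmxA _ (ctr U)) unitary_ctrl // mulmx1.
  rewrite -(mulmxA _ (ctr V)) unitary_ctrl // mulmx1 rdiagE !mulmxA.
  rewrite mul_pid_mx minnn (minn_idPr (geq_minl _ _)) pid_mx_1 mul1mx.
  by rewrite -mulmxA mul_pid_mx minnn (minn_idPr (geq_minr _ _)) pid_mx_1 mulmx1.
have rank_le : (\rank (diag_mx s) <= \rank X)%N.
  rewrite DE -!(mulmxA _ V) -(mulmxA (pid_mx _ *m ctr U)).
  exact: leq_trans (mxrankM_maxr _ _) (mxrankM_maxl _ _).
suff : (k < \rank (diag_mx s))%N by rewrite ltnNge (leq_trans rank_le).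
have <- : \rank ((pid_mx k.+1 : 'M[C]_(minn m n)) *m diag_mx s *m diag_mx s') = k.+1.
  rewrite -mulmxA mulmx_diag; set e := \row_j _.
  have -> : pid_mx k.+1 *m diag_mx e = pid_mx k.+1 :> 'M[C]_(minn m n).
    rewrite mul_mx_diag; apply/matrixP=> i j; rewrite !mxE.
    case: eqP => [ij|]; rewrite ?mul0r //; case: ltnP => [ik|]; rewrite ?mul0r //.
    rewrite divff ?mulr1 //; apply: contra sk0 => /eqP sj0.
    by rewrite eq_le s0 -sj0 sS // -ij.
  by rewrite rank_pid_mx.
exact: leq_trans (mxrankM_maxl _ _) (mxrankM_maxr _ _).
Qed.

(** Singular values from index [r] on vanish, so [r] columns suffice and the sum of the values is
    unchanged. *)
Lemma svd_spec_compact m n (X : 'M[C]_(m, n)) U s V (r := \rank X)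
    (R := U *m pid_mx r : 'M[C]_(m, r)) (S := V *m pid_mx r : 'M[C]_(n, r)) :
  svd_spec X U s V -> exists s' : 'rV[C]_r,
  [/\ forall k, 0 <= s' 0 k, \sum_k s' 0 k = \sum_k s 0 k
    & X = R *m diag_mx s' *m ctr S].
Proof.
move=> Xsvd; have s_rank := svd_spec_rank Xsvd; case: Xsvd => UU VU s0 sS XE.
have rm : (r <= minn m n)%N by rewrite leq_min rank_leq_row rank_leq_col.
pose s' : 'rV[C]_r := \row_i s 0 (widen_ord rm i).
have s_zero (k : 'I_(minn m n)) : ~~ (k < r)%N -> s 0 k = 0.
  by rewrite -leqNgt; exact: s_rank.
exists s'; split=> [k||]; first by rewrite mxE.
  under eq_bigr do rewrite mxE.
  rewrite -(big_ord_narrow (F := fun k => s 0 k) rm) big_mkcond /=; apply: eq_bigr => k _.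
  by case: ifPn => // /s_zero.
rewrite /R /S ctrM ctr_pid -!mulmxA {1}XE -mulmxA; congr (_ *m _).
rewrite !mulmxA; congr (_ *m _); rewrite mul_mx_diag.
apply/matrixP=> i j; rewrite !mxE.
rewrite (eq_bigr (fun k : 'I_r =>
  if (nat_of_ord i == k) && (nat_of_ord j == k) then s 0 (widen_ord rm k) else 0)).
  rewrite -(big_ord_narrow (F := fun k : 'I_(minn m n) =>
    if (nat_of_ord i == k) && (nat_of_ord j == k) then s 0 k else 0) rm).
  rewrite [in RHS]big_mkcond /=; apply: eq_bigr => k _.
  by have [//|/s_zero ->] := boolP (k < r)%N; rewrite if_same.
move=> k _; rewrite !mxE [(k : nat) == j]eq_sym.
case: eqP => [->|_]; rewrite ?ltn_ord /= ?mul1r ?mul0r //.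
by case: eqP; rewrite ?mulr1 ?mulr0.
Qed.

End SVD.

(** * The tangent space at a matrix of rank r *)

Section Tangent.
Variables (C : numClosedFieldType) (m n r : nat).
Variables (R : 'M[C]_(m, r)) (S : 'M[C]_(n, r)).
Hypotheses (RR : ctr R *m R = 1%:M) (SS : ctr S *m S = 1%:M).

Variables (p : 'M[C]_m) (q : 'M[C]_n).
Hypotheses (pE : p = R *m ctr R) (qE : q = S *m ctr S).
Implicit Types X Y : 'M[C]_(m, n).

(** [p] and [q] are variables tied to [R] and [S] by equations, so that they can be instantiated by
    projectors written with the full unitary factors. *)
Definition tproj X := p *m X + X *m q - p *m X *m q.
Definition tprojp X := (1%:M - p) *m X *m (1%:M - q).

Lemma isom_proj_idem k (P : 'M[C]_(k, r)) : ctr P *m P = 1%:M ->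
  (P *m ctr P) *m (P *m ctr P) = P *m ctr P.
Proof. by move=> PP; rewrite mulmxA -(mulmxA P) PP mulmx1. Qed.

Lemma isom_proj_ctr k (P : 'M[C]_(k, r)) : ctr (P *m ctr P) = P *m ctr P.
Proof. by rewrite ctrM ctrK. Qed.

Let pp : p *m p = p. Proof. rewrite pE; exact: isom_proj_idem. Qed.
Let qq : q *m q = q. Proof. rewrite qE; exact: isom_proj_idem. Qed.
Let pc : ctr p = p. Proof. rewrite pE; exact: isom_proj_ctr. Qed.
Let qc : ctr q = q. Proof. rewrite qE; exact: isom_proj_ctr. Qed.

Lemma cproj_idem k (e : 'M[C]_k) : e *m e = e ->
  (1%:M - e) *m (1%:M - e) = 1%:M - e.
Proof. by move=> ee; rewrite mulmxBr mulmx1 mulmxBl mul1mx ee subrr subr0. Qed.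

Lemma tprojE X : tproj X = p *m X + (1%:M - p) *m X *m q.
Proof. by rewrite /tproj mulmxBl mul1mx mulmxBl addrA. Qed.

Lemma tproj_add X : tproj X + tprojp X = X.
Proof.
rewrite tprojE /tprojp [_ *m (1%:M - q)]mulmxBr mulmx1 -addrA subrKC.
by rewrite mulmxBl mul1mx subrKC.
Qed.

Lemma inner_tprojp X Y : inner (tprojp X) Y = inner X (tprojp Y).
Proof.
rewrite /tprojp inner_mulr inner_mull !ctrB !ctr1 pc qc.
by rewrite mulmxA.
Qed.

Lemma tprojp_idem X : tprojp (tprojp X) = tprojp X.
Proof.
rewrite /tprojp !mulmxA cproj_idem // -!mulmxA cproj_idem //.
Qed.

Lemma tprojp_tproj X : tprojp (tproj X) = 0.
Proof.
rewrite tprojE /tprojp [(1%:M - p) *m (_ + _)]mulmxDr !mulmxA.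
rewrite [(1%:M - p) *m p]mulmxBl mul1mx pp subrr mul0mx add0r -!mulmxA.
by rewrite [q *m _]mulmxBr mulmx1 qq subrr !mulmx0.
Qed.

Lemma tprojp_sign : tprojp (R *m ctr S) = 0.
Proof.
rewrite /tprojp mulmxA mulmxBl mul1mx pE -(mulmxA R) RR mulmx1 subrr.
by rewrite !mul0mx.
Qed.

Lemma tprojpB X Y : tprojp (X - Y) = tprojp X - tprojp Y.
Proof. by rewrite /tprojp [_ *m (X - Y)]mulmxBr mulmxBl. Qed.

Lemma tproj_id X : tprojp X = 0 -> tproj X = X.
Proof. by move=> X0; rewrite -{2}(tproj_add X) X0 addr0. Qed.

(** Pythagoras for the orthogonal projector [e]. *)
Lemma inner_idem_split k l (e : 'M[C]_k) (X : 'M[C]_(k, l)) :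
  ctr e = e -> e *m e = e ->
  inner X X = inner (e *m X) (e *m X) + inner ((1%:M - e) *m X) ((1%:M - e) *m X).
Proof.
move=> ec ee; rewrite !inner_mull ctrB ctr1 ec !mulmxA ee cproj_idem //.
by rewrite -innerDr -mulmxDl subrKC mul1mx.
Qed.

Lemma opbound_cproj k (e : 'M[C]_k) :
  ctr e = e -> e *m e = e -> opbound 1 (1%:M - e).
Proof.
move=> ec ee l V; rewrite mul1r; apply: frob_le (frob_ge0 _) _.
by rewrite frob_sqr (inner_idem_split V ec ee) lerDr inner_ge0.
Qed.

Lemma frob_isom_sqr k (P : 'M[C]_(k, r)) : ctr P *m P = 1%:M -> frob P ^+ 2 = r%:R.
Proof.
by move=> PP; rewrite frob_sqr /inner PP mxtrace1; apply/Creal_ReP/realn.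
Qed.

(* A tangent matrix splits into a part with column space of dimension at most r and a part
   with row space of dimension at most r, each of squared Frobenius norm at most r t ^+ 2. *)
Lemma frob_tproj_le t X : 0 <= t -> opbound t X ->
  frob (tproj X) <= sqrtC (2 * r%:R) * t.
Proof.
move=> t0 hX; have s0 : 0 <= 2 * r%:R :> C by rewrite mulr_ge0 ?ler0n.
apply: frob_le; first by rewrite mulr_ge0 ?sqrtC_ge0.
rewrite exprMn sqrtCK (inner_idem_split _ pc pp) tprojE !mulmxDr !mulmxA pp.
have p'p : (1%:M - p) *m p = 0 by rewrite mulmxBl mul1mx pp subrr.
have pp' : p *m (1%:M - p) = 0 by rewrite mulmxBr mulmx1 pp subrr.
rewrite p'p pp' !mul0mx addr0 add0r cproj_idem //.
have -> : 2 * r%:R * t ^+ 2 = (t ^+ 2) * r%:R + (t ^+ 2) * r%:R by ring.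
apply: lerD.
  (* The column part has the norm of [ctr X *m R], at most [t * frob R], and [R] has squared norm
     [r]. *)
  rewrite -frob_sqr pE -mulmxA frob_isom // -frob_ctr ctrM ctrK.
  rewrite -(frob_isom_sqr RR) -exprMn ler_pXn2r ?nnegrE ?mulr_ge0 ?frob_ge0 //.
  exact: opbound_ctr.
(* The row part has the norm of [X *m S] after a contraction by [1%:M - p]. *)
rewrite -frob_sqr qE mulmxA -frob_ctr ctrM ctrK frob_isom // frob_ctr -mulmxA.
rewrite -(frob_isom_sqr SS) -exprMn ler_pXn2r ?nnegrE ?mulr_ge0 ?frob_ge0 //.
apply: le_trans (opbound_cproj pc pp _) _; rewrite mul1r; exact: hX.
Qed.

(* The dual certificate is the sum of the sign matrix of X and of a compression W1
   of the one of tprojp (Y - X): they have orthogonal ranges and orthogonal coimages. *)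
Lemma nucnorm_subgradient X Y (s : 'rV[C]_r) :
  (forall k, 0 <= s 0 k) -> X = R *m diag_mx s *m ctr S ->
  \sum_k s 0 k + inner (R *m ctr S) (Y - X) + nucnorm (tprojp (Y - X)) <= nucnorm Y.
Proof.
move=> s0 XE; have [W0 W0b W0E] := nucnorm_attained (tprojp (Y - X)).
pose W1 := tprojp W0.
have pX : (1%:M - p) *m X = 0.
  by rewrite XE !mulmxA mulmxBl mul1mx pE -(mulmxA R) RR mulmx1 subrr !mul0mx.
have W1X : inner W1 X = 0 by rewrite inner_tprojp /tprojp pX mul0mx inner0r.
have UVX : inner (R *m ctr S) X = \sum_k s 0 k by rewrite XE inner_svd_eq.
(* The sign matrix sees only [q *m V] and lands in the range of [p]; [W1] sees only the complement
   and lands in the complement. Pythagoras on both sides adds the two bounds. *)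
have Wb : opbound 1 (R *m ctr S + W1).
  move=> k V; rewrite mul1r; apply: frob_le (frob_ge0 _) _; rewrite frob_sqr.
  have pR : p *m R = R by rewrite pE -mulmxA RR mulmx1.
  have p'R : (1%:M - p) *m R = 0 by rewrite mulmxBl mul1mx pR subrr.
  have pp' : p *m (1%:M - p) = 0 by rewrite mulmxBr mulmx1 pp subrr.
  have qS : q *m V = S *m (ctr S *m V) by rewrite qE mulmxA.
  have pW : p *m (R *m ctr S + W1) = R *m ctr S.
    by rewrite mulmxDr /W1 /tprojp !mulmxA pR pp' !mul0mx addr0.
  have p'W : (1%:M - p) *m (R *m ctr S + W1) = W1.
    by rewrite mulmxDr /W1 /tprojp !mulmxA p'R cproj_idem // !mul0mx add0r.
  rewrite (inner_idem_split _ pc pp) 2!mulmxA pW p'W /W1 /tprojp -(mulmxA R).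
  rewrite (inner_idem_split V qc qq) -!frob_sqr qS.
  rewrite (frob_isom _ RR) (frob_isom _ SS) lerD2l ler_pXn2r ?nnegrE ?frob_ge0 //.
  rewrite -2!mulmxA.
  apply: le_trans (opbound_cproj pc pp _) _; rewrite mul1r.
  by apply: le_trans (W0b _ _) _; rewrite mul1r.
apply: le_trans (_ : inner (R *m ctr S + W1) Y <= _); last first.
  by rewrite -[nucnorm Y]mul1r; exact: inner_nucnorm_le.
rewrite -W0E -inner_tprojp -/W1 -UVX innerDl !innerBr W1X subr0.
by rewrite subrKC.
Qed.

(** On T, Cauchy-Schwarz with the rank bound on [tproj X]; off T, self-adjointness moves the
    projection to [Y] and duality applies. *)
Lemma inner_tangent_le t X Y : 0 <= t -> opbound t X ->
  inner X Y <= sqrtC (2 * r%:R) * t * frob Y + t * nucnorm (tprojp Y).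
Proof.
move=> t0 hX; rewrite -{1}(tproj_add X) innerDl inner_tprojp; apply: lerD.
  apply: le_trans (inner_CauchySchwarz _ _) _.
  by rewrite ler_wpM2r ?frob_ge0 // frob_tproj_le.
exact: inner_nucnorm_le.
Qed.

(** In the subgradient inequality, replacing the sign matrix by [G] costs the [a] term on T and [g]
    times the nuclear norm off T. *)
Lemma nucnorm_gap_ge X Y G (s : 'rV[C]_r)
    (a := specnorm (R *m ctr S - tproj G)) (g := specnorm (tprojp G)) :
  (forall k, 0 <= s 0 k) -> X = R *m diag_mx s *m ctr S ->
  (1 - g) * nucnorm (tprojp (Y - X)) - sqrtC (2 * r%:R) * a * frob (Y - X)
    <= nucnorm Y - \sum_k s 0 k - inner G (Y - X).
Proof.
move=> s0 XE; have := nucnorm_subgradient Y s0 XE.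
set D := Y - X; set z := nucnorm (tprojp D) => sub.
have hA : inner (tproj G - R *m ctr S) D <= sqrtC (2 * r%:R) * a * frob D.
  (* The difference is tangent, hence fixed by [tproj], so its own spectral norm [a] controls its
     Frobenius norm. *)
  have A0 : tprojp (tproj G - R *m ctr S) = 0.
    by rewrite tprojpB tprojp_tproj tprojp_sign subr0.
  rewrite -(tproj_id A0); apply: le_trans (inner_CauchySchwarz _ _) _.
  rewrite ler_wpM2r ?frob_ge0 //; apply: frob_tproj_le (specnorm_ge0 _) _ => k V.
  rewrite -opprB mulNmx /frob innerNl innerNr opprK; exact: opbound_specnorm.
have hG : inner (tprojp G) D <= g * z.
  rewrite -tprojp_idem inner_tprojp.
  exact: inner_nucnorm_le (specnorm_ge0 _) (opbound_specnorm _).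
have -> : inner G D =
    inner (tproj G - R *m ctr S) D + inner (R *m ctr S) D + inner (tprojp G) D.
  by rewrite -!innerDl subrK tproj_add.
rewrite -subr_ge0 in sub; rewrite -subr_ge0 in hA; rewrite -subr_ge0 in hG.
rewrite -subr_ge0.
have := addr_ge0 (addr_ge0 sub hA) hG; congr (0 <= _); ring.
Qed.

End Tangent.

(** * The error bound for optimal solutions of (RC) *)

Theorem mainTheorem1
  (C : numClosedFieldType) (sp : mat_space) (n1 n2 d m : nat)
  (Theta : 'I_d -> 'M[C]_(n1, n2))
  (alpha : {set 'I_d})
  (Xbar : 'M[C]_(n1, n2)) (Ubar : 'M[C]_n1) (Vbar : 'M[C]_n2)
  (omega : 'I_m -> 'I_d) (xi : 'I_m -> C) (nu : C)
  (f : 'rV[C]_(minn n1 n2) -> 'rV[C]_(minn n1 n2))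
  (Xtil : 'M[C]_(n1, n2)) (rho gamma : C)
  (Xhat : 'M[C]_(n1, n2)) (kappa : C) :
  (* orthonormal basis of V *)
  (forall k, in_space sp (Theta k)) ->
  (forall k l, inner (Theta k) (Theta l) = (k == l)%:R) ->
  (forall X, in_space sp X -> X = \sum_k inner (Theta k) X *: Theta k) ->
  (* the unknown matrix, its rank and a fixed SVD *)
  in_space sp Xbar ->
  (0 < \rank Xbar)%N ->
  svd_spec Xbar Ubar (sigma Xbar) Vbar ->
  (* sampling *)
  (0 < m)%N ->
  (forall i, omega i \notin alpha) ->
  (forall i, xi i \is Num.real) ->
  0 < nu ->
  (* spectral operator *)
  symmetric_fun f ->
  in_space sp Xtil ->
  0 < rho -> 0 <= gamma ->
  let r := \rank Xbar in
  let y := fun i => inner (Theta (omega i)) Xbar + nu * xi i in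
  let obj := fun X : 'M[C]_(n1, n2) =>
    (2 * m%:R)^-1 * \sum_i (y i - inner (Theta (omega i)) X) ^+ 2
    + rho * (nucnorm X - inner (spec_op f Xtil) X
             + gamma / 2 * frob (X - Xtil) ^+ 2) in
  let feasible := fun X : 'M[C]_(n1, n2) =>
    in_space sp X /\ forall k, k \in alpha -> inner (Theta k) X = inner (Theta k) Xbar in
  (* Xhat is an optimal solution of (RC) *)
  feasible Xhat -> (forall X, feasible X -> obj Xhat <= obj X) ->
  let PU := Ubar *m (pid_mx r : 'M[C]_n1) *m ctr Ubar in
  let PV := Vbar *m (pid_mx r : 'M[C]_n2) *m ctr Vbar in
  let PT := fun Y : 'M[C]_(n1, n2) => PU *m Y + Y *m PV - PU *m Y *m PV in
  let PTp := fun Y : 'M[C]_(n1, n2) => (1%:M - PU) *m Y *m (1%:M - PV) in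
  let G := spec_op f Xtil + gamma *: Xtil in
  let a := specnorm (Ubar *m (pid_mx r : 'M[C]_(n1, n2)) *m ctr Vbar - PT G) in
  let b := 1 - specnorm (PTp G) in
  specnorm (PTp G) < 1 ->
  1 < kappa ->
  rho >= kappa * nu / b * specnorm ((m%:R)^-1 *: \sum_i xi i *: Theta (omega i)) ->
  (2 * m%:R)^-1 * \sum_i (inner (Theta (omega i)) (Xhat - Xbar)) ^+ 2
  <= sqrtC (2 * r%:R) * (a + b / kappa) * rho * frob (Xhat - Xbar)
     + rho * gamma / 2 * (frob Xbar ^+ 2 - frob Xhat ^+ 2).
Proof.
move=> _ _ _ hXbar _ svdX m_gt0 _ xiR nu_gt0 _ _ rho_gt0 gamma_ge0 r y obj feasible.
move=> _ opt PU PV PT PTp G a b g_lt1 kappa_gt1 rho_ge.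
have {}opt : obj Xhat <= obj Xbar by apply: opt; split.
have [UU VU _ _ _] := svdX; have [s [s0 ss XE]] := svd_spec_compact svdX.
pose R := Ubar *m (pid_mx r : 'M_(n1, r)); pose S := Vbar *m (pid_mx r : 'M_(n2, r)).
have rn1 : (r <= n1)%N by exact: rank_leq_row.
have rn2 : (r <= n2)%N by exact: rank_leq_col.
have RR : ctr R *m R = 1%:M by exact: isom_mul_pid.
have SS : ctr S *m S = 1%:M by exact: isom_mul_pid.
have PUE : PU = R *m ctr R.
  rewrite /PU /R ctrM ctr_pid !mulmxA -[in RHS](mulmxA Ubar) mul_pid_mx.
  by rewrite !minnn.
have PVE : PV = S *m ctr S.
  rewrite /PV /S ctrM ctr_pid !mulmxA -[in RHS](mulmxA Vbar) mul_pid_mx.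
  by rewrite !minnn.
have UVE : Ubar *m (pid_mx r : 'M_(n1, n2)) *m ctr Vbar = R *m ctr S.
  rewrite /R /S ctrM ctr_pid !mulmxA -[in RHS](mulmxA Ubar) mul_pid_mx.
  by rewrite !minnn.
pose D := Xhat - Xbar; pose z := nucnorm (PTp D); pose F := frob D.
pose N := (m%:R)^-1 *: \sum_i xi i *: Theta (omega i).
have gap := nucnorm_gap_ge RR SS PUE PVE Xhat G s0 XE.
have noise := inner_tangent_le RR SS PUE PVE D (specnorm_ge0 N) (opbound_specnorm N).
rewrite ss -/(nucnorm Xbar) in gap.
rewrite -/(PTp G) -/(PT G) -UVE -/a -/b -/D -/(PTp D) -/z -/F -/r in gap.
rewrite -/(PTp D) -/z -/F -/r in noise.
set t := sqrtC (2 * r%:R) in gap noise *.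
set eta := specnorm N in noise; rewrite -/N -/eta in rho_ge.
have m_neq0 : m%:R != 0 :> C by rewrite pnatr_eq0 -lt0n.
have nuR : nu \is Num.real by exact: gtr0_real.
have gammaR : gamma \is Num.real by exact: ger0_real.
have mR : (m%:R : C)^-1 \is Num.real by rewrite rpredV realn.
have b_gt0 : 0 < b by rewrite subr_gt0.
have kappa_gt0 : 0 < kappa by exact: lt_trans kappa_gt1.
have z_ge0 : 0 <= z by exact: nucnorm_ge0.
have tF_ge0 : 0 <= t * F.
  by rewrite mulr_ge0 ?frob_ge0 // sqrtC_ge0 mulr_ge0 ?ler0n.
set Q := (2 * m%:R)^-1 * _.
have NE : inner N D = (m%:R)^-1 * \sum_i xi i * inner (Theta (omega i)) D.
  rewrite innerC innerZr // inner_sumr; congr (_ * _); apply: eq_bigr => i _.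
  by rewrite innerZr // innerC.
(* The residual is [nu * xi i] at [Xbar], and that minus the pairing with [D] at [Xhat]. *)
have lossE : (2 * m%:R)^-1 * (\sum_i (y i - inner (Theta (omega i)) Xbar) ^+ 2
    - \sum_i (y i - inner (Theta (omega i)) Xhat) ^+ 2) = nu * inner N D - Q.
  rewrite NE /Q -sumrB mulrA [in RHS]mulr_sumr [X in _ - X]mulr_sumr -sumrB mulr_sumr.
  apply: eq_bigr => i _; rewrite -/D /y [inner _ D]innerBr; field.
  exact: m_neq0.
(* The cross term, weighted by [gamma / 2], is what adds [gamma *: Xtil] to the spectral operator in
   [G]. *)
have proxE : frob (Xbar - Xtil) ^+ 2 - frob (Xhat - Xtil) ^+ 2 =
    frob Xbar ^+ 2 - frob Xhat ^+ 2 + 2 * inner Xtil D.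
  rewrite !frob_sqr /D !innerBr !innerBl (innerC Xbar Xtil) (innerC Xhat Xtil); ring.
have GE : inner G D = inner (spec_op f Xtil) D + gamma * inner Xtil D.
  by rewrite /G innerDl innerZl.
have FE : inner (spec_op f Xtil) D =
    inner (spec_op f Xtil) Xhat - inner (spec_op f Xtil) Xbar by exact: innerBr.
have optE : obj Xbar - obj Xhat = nu * inner N D - Q
    + rho * (nucnorm Xbar - nucnorm Xhat + inner G D
             + gamma / 2 * (frob Xbar ^+ 2 - frob Xhat ^+ 2)).
  rewrite -lossE GE FE /obj -[frob Xbar ^+ 2 - _](addrK (2 * inner Xtil D)) -proxE.
  by field.
set k := b / kappa.
have k_le : k <= b by rewrite ler_pdivrMr // ler_peMr // ltW.
(* The lower bound on [rho], cleared of denominators. *)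
have noise_le : nu * eta <= rho * k.
  rewrite /k mulrA ler_pdivlMr //.
  move: rho_ge; rewrite mulrAC ler_pdivrMr //; congr (_ <= _); ring.
rewrite -subr_ge0 optE in opt; rewrite -subr_ge0 in gap; rewrite -subr_ge0 in noise.
have := mulr_ge0 (ltW nu_gt0) noise; have := mulr_ge0 (ltW rho_gt0) gap.
have : 0 <= (rho * k - nu * eta) * (t * F + z).
  by apply: mulr_ge0; [rewrite subr_ge0 | exact: addr_ge0].
have : 0 <= rho * z * (b - k) by rewrite !mulr_ge0 ?subr_ge0 // ltW.
move=> h1 h2 h3 h4; rewrite -subr_ge0.
(* The right side minus the left is exactly the sum of these five nonnegative terms; [z], [eta] and
   the pairings with [N] and [G] cancel. *)
have := addr_ge0 (addr_ge0 (addr_ge0 (addr_ge0 h1 h2) h3) h4) opt.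
congr (0 <= _); rewrite -/k -/F -/Q; by field.
Qed.
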